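(* Let $(M^2,g)$ be a connected, oriented pseudo-Riemannian (possibly Riemannian) 2-manifold with Levi-Civita connection $\nabla$, natural volume form $\Omega$, and natural almost (para)complex structure $J$. Let $\alpha\colon I\to M^2$ be a Frenet (that is, non-singular) curve. Then its Frenet curvature $\kappa_r\colon I\to\mathbb R$ is given by $$\kappa_r=\frac{\Omega(\alpha',\nabla_{\alpha'}\alpha')}{|g(\alpha',\alpha')|^{3/2}}=-\frac{g(\nabla_{\alpha'}\alpha',J\alpha')}{|g(\alpha',\alpha')|^{3/2}}.$$
   Context: The metric $g$ may have signature $(++)$, $(--)$ or $(+-)$; put $\omega=1$ for $(++)$ or $(--)$ and $\omega=-1$ for $(+-)$. The natural volume form $\Omega$ is the 2-form compatible with the orientation given in positively oriented local coordinates $(x^1,x^2)$ by $\Omega=\sqrt{|G|}\,(dx^1\otimes dx^2-dx^2\otimes dx^1)$, where $G=g_{11}g_{22}-g_{12}^2$ (so $\Omega(u,v)=\pm1$ for orthonormal $u,v$, positive when $(u,v)$ is positively oriented). The $(1,1)$-tensor field $J$ is defined by $g(X,JY)=\Omega(X,Y)$ for all vector fields $X,Y$; it satisfies $J^2=-\omega\,\mathrm{Id}$. For a smooth curve $\alpha\colon I\to M^2$ ($I$ an open interval), $\nabla_{\alpha'}$ is covariant differentiation along $\alpha$ with respect to the parameter $t\in I$. The curve is non-singular if $g(\alpha'(t),\alpha'(t))\ne0$ for all $t\in I$. For such a curve put $\nu=|g(\alpha',\alpha')|^{1/2}$ (speed), $\mathbf T=\alpha'/\nu$, $\varepsilon=g(\mathbf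 T,\mathbf T)\in\{1,-1\}$, $\mathbf N=-\omega\varepsilon J\mathbf T$. Then $\mathbf N$ is the unique unit vector field along $\alpha$ orthogonal to $\mathbf T$ with $(\mathbf T,\mathbf N)$ positively oriented; $g(\mathbf N,\mathbf N)=\omega\varepsilon$ and $\Omega(\mathbf T,\mathbf N)=1$. Write $\nabla_{\mathbf T}=\nu^{-1}\nabla_{\alpha'}$. Since $\nabla_{\mathbf T}\mathbf T$ is orthogonal to $\mathbf T$, there is a unique function $\kappa_r\colon I\to\mathbb R$ with $\nabla_{\mathbf T}\mathbf T=\kappa_r\mathbf N$; it is called the (oriented, Frenet) curvature of $\alpha$. *)

(* Defs.v *)
From HB Require Import structures.
From mathcomp Require Import all_boot all_order all_algebra.
From mathcomp Require Import all_classical all_reals all_analysis.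
From mathcomp Require Import ring.

Set Implicit Arguments.
Unset Strict Implicit.
Unset Printing Implicit Defensive.

Import Order.TTheory GRing.Theory Num.Theory.
Import numFieldNormedType.Exports.

Local Open Scope classical_set_scope.
Local Open Scope ring_scope.

(** * Smooth maps between finite-dimensional normed spaces *)

(* [Ck k O f], for an open set [O]: [f] has continuous partial derivatives on
   [O] up to order [k].  On a finite-dimensional [V] this is the class C^k. *)
Fixpoint Ck (R : realType) (V W : normedModType R) (k : nat) (O : set V)
    (f : V -> W) : Prop :=
  if k is k'.+1 then
    (forall x, O x -> differentiable f x) /\
    (forall v : V, Ck k' O (fun x => 'D_v f x))
  else forall x, O x -> {for x, continuous f}.

Definition smooth_near (R : realType) (V W : normedModType R) (f : V -> W)
    (x : V) : Prop :=
  exists2 O : set V, open_nbhs x O & forall k, Ck k O f.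

(** * Connected oriented smooth surfaces *)

(* The structure is given by an oriented atlas [chart].  The functions [phi i]
   and [psi i] are total, but only the restrictions
   [phi i : dom i -> phi i @` dom i] and their inverses [psi i] carry
   information. *)
Record surface (R : realType) : Type := Surface {
  carrier :> topologicalType ;
  carrier_hausdorff : hausdorff_space carrier ;
  carrier_second_countable : @second_countable carrier ;
  carrier_connected : connected [set: carrier] ;
  chart : Type ;
  dom : chart -> set carrier ;
  phi : chart -> carrier -> 'rV[R]_2 ;
  psi : chart -> 'rV[R]_2 -> carrier ;
  dom_open : forall i, open (dom i) ;
  im_open : forall i, open (phi i @` dom i) ;
  phi_continuous : forall i p, dom i p -> {for p, continuous (phi i)} ;
  psi_continuous : forall i p, dom i p -> {for phi i p, continuous (psi i)} ;
  phiK : forall i p, dom i p -> psi i (phi i p) = p ;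
  dom_cover : forall p, exists i, dom i p ;
  trans_smooth : forall i j p, dom i p -> dom j p ->
    smooth_near (phi j \o psi i) (phi i p) ;
  trans_oriented : forall i j p, dom i p -> dom j p ->
    0 < \det (jacobian (phi j \o psi i) (phi i p))
}.
Arguments chart {R} s.
Arguments dom {R s}.
Arguments phi {R s}.
Arguments psi {R s}.

Definition transition (R : realType) (M : surface R) (i j : chart M) :
  'rV[R]_2 -> 'rV[R]_2 := phi j \o psi i.

Definition chart_at (R : realType) (M : surface R) (p : M) : chart M :=
  projT1 (cid (dom_cover p)).

Lemma chart_atP (R : realType) (M : surface R) (p : M) : dom (chart_at p) p.
Proof. exact: projT2 (cid (dom_cover p)). Qed.

(** * Tangent vectors *)

(* A tangent vector at [p] is the family of its coordinate vectors in all the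
   charts around [p]; by convention its components are 0 in other charts. *)
Definition is_tangent (R : realType) (M : surface R) (p : M) :
    {pred (chart M -> 'rV[R]_2)} :=
  fun v => `[< (forall i, ~ dom i p -> v i = 0) /\
    (forall i j, dom i p -> dom j p ->
       v j = 'd (transition i j) (phi i p) (v i)) >].

Record tangent (R : realType) (M : surface R) (p : M) : Type := Tangent {
  tcomp :> chart M -> 'rV[R]_2 ;
  _ : tcomp \in @is_tangent R M p }.

HB.instance Definition _ (R : realType) (M : surface R) (p : M) :=
  [isSub for @tcomp R M p].
HB.instance Definition _ (R : realType) (M : surface R) (p : M) :=
  [Choice of tangent p by <:].

Lemma is_tangent_submod (R : realType) (M : surface R) (p : M) :
  submod_closed (@is_tangent R M p).
Proof.
split=> [|a u v].
  by apply/asboolP; split=> // i j _ _; rewrite linear0.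
move=> /asboolP[u0 uc] /asboolP[v0 vc]; apply/asboolP.
have E k : (a *: u + v) k = a *: u k + v k by [].
split=> [i pi|i j pi pj]; rewrite !E.
  by rewrite u0// v0// scaler0 addr0.
by rewrite (uc i)// (vc i)// linearP.
Qed.

HB.instance Definition _ (R : realType) (M : surface R) (p : M) :=
  GRing.isSubmodClosed.Build R (chart M -> 'rV[R]_2) (@is_tangent R M p)
    (@is_tangent_submod R M p).
HB.instance Definition _ (R : realType) (M : surface R) (p : M) :=
  [SubChoice_isSubLmodule of tangent p by <:].

Lemma smooth_near_differentiable (R : realType) (V W : normedModType R)
  (f : V -> W) (x : V) : smooth_near f x -> differentiable f x.
Proof. by case=> O [_ Ox] /(_ 1%N)[/(_ x Ox)]. Qed.

Lemma trans_differentiable (R : realType) (M : surface R) (i j : chart M)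
  (p : M) : dom i p -> dom j p -> differentiable (transition i j) (phi i p).
Proof.
by move=> pi pj; have /smooth_near_differentiable := trans_smooth pi pj.
Qed.

Lemma diff_near_comp (R : realType) (U V W : normedModType R) (f : U -> V)
    (g : V -> W) (h : U -> W) (x v : U) :
  differentiable f x -> differentiable g (f x) -> differentiable h x ->
  (\forall y \near x, h y = g (f y)) ->
  'd g (f x) ('d f x v) = 'd h x v.
Proof.
move=> df dg dh hE; rewrite -[RHS]deriveE// (near_eq_derive _ hE).
have dgf : differentiable (g \o f) x by exact: differentiable_comp.
by rewrite (deriveE v dgf) (diff_comp df dg).
Qed.

Lemma diff_near_id (R : realType) (V : normedModType R) (f : V -> V)
    (x v : V) :
  differentiable f x -> (\forall y \near x, f y = y) -> 'd f x v = v.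
Proof.
move=> df fE; rewrite -deriveE// (@near_eq_derive _ _ _ f id x v fE).
exact: derive_id.
Qed.

Lemma dtransM (R : realType) (M : surface R) (i j k : chart M) (p : M) v :
  dom i p -> dom j p -> dom k p ->
  'd (transition j k) (phi j p) ('d (transition i j) (phi i p) v) =
  'd (transition i k) (phi i p) v.
Proof.
move=> pi pj pk.
have E : transition i j (phi i p) = phi j p by rewrite /transition /= phiK.
have dij := trans_differentiable pi pj.
have djk : differentiable (transition j k) (transition i j (phi i p)).
  by rewrite E; exact: trans_differentiable.
have dik := trans_differentiable pi pk.
have pj' : nbhs (psi i (phi i p)) (dom j).
  by rewrite phiK//; apply: open_nbhs_nbhs; split=> //; exact: dom_open.
have pjx : \forall x \near phi i p, dom j (psi i x).
  exact: psi_continuous pi _ pj'.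
have H : \forall x \near phi i p,
    transition i k x = transition j k (transition i j x).
  by apply: filterS pjx => x xj; rewrite /transition /= phiK.
by have := diff_near_comp v dij djk dik H; rewrite E.
Qed.

Definition vec_comp (R : realType) (M : surface R) (p : M) (i : chart M)
    (w : 'rV[R]_2) : chart M -> 'rV[R]_2 :=
  fun j => if `[< dom i p /\ dom j p >]
           then 'd (transition i j) (phi i p) w else 0.

Lemma vec_comp_tangent (R : realType) (M : surface R) (p : M) (i : chart M) w :
  vec_comp p i w \in @is_tangent R M p.
Proof.
apply/asboolP; rewrite /vec_comp; split=> [j pj|j k pj pk].
  by case: asboolP => // -[].
case: asboolP => [[pi _]|nij]; case: asboolP => [[pi' _]|nik] //.
- by have := dtransM w pi pj pk; move/esym.
- by case: nik.
- by case: nij.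
- by rewrite linear0.
Qed.

(* The tangent vector at [p] whose components in the chart [i] are [w]
   (see [vec_of_chart]); it is 0 if [p] is not in the domain of [i]. *)
Definition vec_of (R : realType) (M : surface R) (p : M) (i : chart M)
  (w : 'rV[R]_2) : tangent p := Tangent (vec_comp_tangent p i w).

Lemma vec_of_chart (R : realType) (M : surface R) (p : M) (i : chart M) w :
  dom i p -> vec_of p i w i = w.
Proof.
move=> pi; rewrite /vec_of /= /vec_comp; case: asboolP => [_|[]//].
apply: diff_near_id; first exact: trans_differentiable.
have : open_nbhs (phi i p) (phi i @` dom i).
  by split; [exact: im_open|exists p].
move/open_nbhs_nbhs; apply: filterS => _ [q qi <-].
by rewrite /transition /= phiK.
Qed.

(** * Functions and vector fields *)

Definition vfield (R : realType) (M : surface R) : Type :=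
  forall p : M, tangent p.

Definition smooth_fun_at (R : realType) (M : surface R) (f : M -> R) (p : M) :
    Prop :=
  exists2 i, dom i p & smooth_near (f \o psi i : 'rV[R]_2 -> R^o) (phi i p).

Definition smooth_field_at (R : realType) (M : surface R) (X : vfield M)
    (p : M) : Prop :=
  exists2 i, dom i p & smooth_near (fun x => X (psi i x) i) (phi i p).

Definition coord_field (R : realType) (M : surface R) (i : chart M)
  (a : 'I_2) : vfield M := fun p => vec_of p i (delta_mx 0 a).

(* [dird v f] is the derivative of [f] in the direction of the tangent
   vector [v]. *)
Definition dird (R : realType) (M : surface R) (p : M) (v : tangent p)
    (f : M -> R) : R :=
  let i := chart_at p in
  'd (f \o psi i : 'rV[R]_2 -> R^o) (phi i p) (v i).

(** * Pseudo-Riemannian metrics *)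

Record metric (R : realType) (M : surface R) : Type := Metric {
  inner :> forall p : M, tangent p -> tangent p -> R ;
  inner_linear : forall p (a : R) (u v w : tangent p),
    inner (a *: u + v) w = a * inner u w + inner v w ;
  inner_sym : forall p (u v : tangent p), inner u v = inner v u ;
  inner_nondegenerate : forall p (u : tangent p),
    (forall v, inner u v = 0) -> u = 0 ;
  inner_smooth : forall p (X Y : vfield M),
    smooth_field_at X p -> smooth_field_at Y p ->
    smooth_fun_at (fun q => inner (X q) (Y q)) p
}.
Arguments inner {R M} m {p} _ _ : rename.

(* Signature (++) or (--) at [p]. *)
Definition definite_at (R : realType) (M : surface R) (g : metric M) (p : M) :
    Prop :=
  (forall v : tangent p, v != 0 -> 0 < g p v v) \/
  (forall v : tangent p, v != 0 -> g p v v < 0).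

(* Since [g] is non-degenerate and [M] connected, [omega g p] does not depend
   on [p]. *)
Definition omega (R : realType) (M : surface R) (g : metric M) (p : M) : R :=
  if `[< definite_at g p >] then 1 else -1.

Definition gram (R : realType) (M : surface R) (g : metric M) (i : chart M)
    (p : M) : R :=
  let e a := @coord_field R M i a p in
  g p (e 0) (e 0) * g p (e 1) (e 1) - g p (e 0) (e 1) ^+ 2.

(* All the charts are positively oriented; any chart around [p] gives the same
   value, see [OmegaE]. *)
Definition Omega (R : realType) (M : surface R) (g : metric M) (p : M)
    (u v : tangent p) : R :=
  let i := chart_at p in
  Num.sqrt `|gram g i p| * (u i 0 0 * v i 0 1 - v i 0 0 * u i 0 1).

Lemma tangent_transition (R : realType) (M : surface R) (p : M)
    (i j : chart M) (u : tangent p) :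
  dom i p -> dom j p -> u j = u i *m jacobian (transition i j) (phi i p).
Proof.
case: u => u /= /asboolP[_ uc] pi pj.
by rewrite (uc _ _ pi pj); symmetry; exact: mul_rV_lin1.
Qed.

Lemma tangent_coord (R : realType) (M : surface R) (p : M) (i : chart M)
    (u : tangent p) :
  dom i p -> u = u i 0 0 *: coord_field i 0 p + u i 0 1 *: coord_field i 1 p.
Proof.
move=> pi; apply: val_inj; apply/funext => j.
have [pj|npj] := pselect (dom j p); last first.
  have ng (w : tangent p) : w j = 0.
    by case: w => w /= /asboolP[w0 _]; exact: w0.
  by rewrite [LHS]ng; symmetry; exact: ng.
rewrite [LHS](tangent_transition u pi pj); symmetry.
rewrite [LHS](tangent_transition _ pi pj); congr (_ *m _).
rewrite [LHS](_ : _ = u i 0 0 *: coord_field i 0 p i +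
                      u i 0 1 *: coord_field i 1 p i) //.
rewrite /coord_field !vec_of_chart //.
apply/rowP => a; rewrite !mxE /=.
have [->|->] : a = 0 \/ a = 1.
  by case: a => -[|[|//]] ia; [left|right]; exact/val_inj.
- by rewrite !mulr1 mulr0 addr0.
- by rewrite mulr0 mulr1 add0r.
Qed.

Lemma det_mx22 (R : comRingType) (A : 'M[R]_2) :
  \det A = A 0 0 * A 1 1 - A 0 1 * A 1 0.
Proof.
rewrite (expand_det_row _ 0) !big_ord_recl big_ord0 addr0 /cofactor.
rewrite !det_mx11 !mxE /= expr0 expr1 mul1r mulN1r mulrN.
rewrite (_ : lift 0 0 = 1); last exact/val_inj.
by rewrite (_ : lift 1 0 = 0); last exact/val_inj.
Qed.

Lemma OmegaE (R : realType) (M : surface R) (g : metric M) (p : M)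
    (i : chart M) (u v : tangent p) : dom i p ->
  Omega g u v =
  Num.sqrt `|gram g i p| * (u i 0 0 * v i 0 1 - v i 0 0 * u i 0 1).
Proof.
move=> pi; rewrite /Omega /=; move: (chart_at p) (chart_atP p) => j pj.
have [A Aw Apos] : exists2 A : 'M[R]_2,
    (forall w : tangent p, w j = w i *m A) & 0 < \det A.
  exists (jacobian (transition i j) (phi i p)); last exact: trans_oriented.
  by move=> w; exact: tangent_transition.
rewrite det_mx22 in Apos.
have mE (w : tangent p) b : w j 0 b = w i 0 0 * A 0 b + w i 0 1 * A 1 b.
  rewrite Aw mxE !big_ord_recl big_ord0 addr0.
  by congr (_ + _ * A _ _); [congr (w i _ _); exact/val_inj|exact/val_inj].
have eC a b : coord_field i a p j 0 b = A a b.
  rewrite mE; have -> : coord_field i a p i = delta_mx 0 a.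
    exact: vec_of_chart.
  rewrite !mxE /=; have [->|->] : a = 0 \/ a = 1.
    by case: a => -[|[|//]] ia; [left|right]; exact/val_inj.
  - by rewrite mul1r mul0r addr0.
  - by rewrite mul1r mul0r add0r.
have eE a : coord_field i a p =
    A a 0 *: coord_field j 0 p + A a 1 *: coord_field j 1 p.
  by rewrite -!eC; exact: tangent_coord.
have gZ (x y : R) (w1 w2 w : tangent p) :
    g p (x *: w1 + y *: w2) w = x * g p w1 w + y * g p w2 w.
  rewrite inner_linear; congr (_ + _).
  have := inner_linear g y w2 0 w; rewrite addr0 => ->.
  suff -> : g p 0 w = 0 by rewrite addr0.
  by have := inner_linear g 1 0 0 w; rewrite scale1r addr0 mul1r => /esym/eqP;
    rewrite addrC -subr_eq0 addrK => /eqP.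
have gZr (x y : R) (w1 w2 w : tangent p) :
    g p w (x *: w1 + y *: w2) = x * g p w w1 + y * g p w w2.
  by rewrite inner_sym gZ !(inner_sym _ w).
have -> : gram g i p = (A 0 0 * A 1 1 - A 0 1 * A 1 0) ^+ 2 * gram g j p.
  rewrite /gram !eE !gZ !gZr (inner_sym g (coord_field j 1 p)).
  by ring.
rewrite normrM ger0_norm ?sqr_ge0// sqrtrM ?sqr_ge0// sqrtr_sqr.
by rewrite (gtr0_norm Apos) !mE; ring.
Qed.

Definition natural_J (R : realType) (M : surface R) (g : metric M)
    (J : forall p : M, tangent p -> tangent p) : Prop :=
  forall p (u v : tangent p), g p u (J p v) = Omega g u v.

(** * The Levi-Civita connection *)

(* [nabla p v Y] is the derivative at [p] of the vector field [Y], defined and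
   smooth near [p], in the direction of the tangent vector [v]. *)
Record connection (R : realType) (M : surface R) : Type := Connection {
  cov :> forall p : M, tangent p -> vfield M -> tangent p ;
  cov_local : forall p (v : tangent p) (Y Z : vfield M),
    smooth_field_at Y p -> (\forall q \near p, Y q = Z q) ->
    cov v Y = cov v Z ;
  cov_linear : forall p (a : R) (u v : tangent p) (Y : vfield M),
    smooth_field_at Y p -> cov (a *: u + v) Y = a *: cov u Y + cov v Y ;
  cov_add : forall p (v : tangent p) (Y Z : vfield M),
    smooth_field_at Y p -> smooth_field_at Z p ->
    cov v (fun q => Y q + Z q) = cov v Y + cov v Z ;
  cov_leibniz : forall p (v : tangent p) (f : M -> R) (Y : vfield M),
    smooth_fun_at f p -> smooth_field_at Y p ->
    cov v (fun q => f q *: Y q) = dird v f *: Y p + f p *: cov v Y ;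
  cov_smooth : forall p (X Y : vfield M),
    smooth_field_at X p -> smooth_field_at Y p ->
    smooth_field_at (fun q => cov (X q) Y) p
}.
Arguments cov {R M} c {p} _ _ : rename.

(* nabla_X Y - nabla_Y X = [X, Y], where [X, Y] f = X (Y f) - Y (X f). *)
Definition torsion_free (R : realType) (M : surface R)
    (nabla : connection M) : Prop :=
  forall p (X Y : vfield M) (f : M -> R),
    smooth_field_at X p -> smooth_field_at Y p -> smooth_fun_at f p ->
    dird (nabla p (X p) Y - nabla p (Y p) X) f =
    dird (X p) (fun q => dird (Y q) f) - dird (Y p) (fun q => dird (X q) f).

Definition metric_compatible (R : realType) (M : surface R) (g : metric M)
    (nabla : connection M) : Prop :=
  forall p (v : tangent p) (Y Z : vfield M),
    smooth_field_at Y p -> smooth_field_at Z p ->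
    dird v (fun q => g q (Y q) (Z q)) =
    g p (nabla p v Y) (Z p) + g p (Y p) (nabla p v Z).

Definition levi_civita (R : realType) (M : surface R) (g : metric M)
    (nabla : connection M) : Prop :=
  torsion_free nabla /\ metric_compatible g nabla.

(** * Curves *)

(* Curves and vector fields along them are total functions of which only the
   restriction to the open interval [I] matters. *)
Definition smooth_curve (R : realType) (M : surface R) (I : set R)
    (alpha : R -> M) : Prop :=
  forall t, I t -> {for t, continuous alpha} /\
    exists2 i, dom i (alpha t) & smooth_near (phi i \o alpha : R^o -> _) t.

Definition velocity (R : realType) (M : surface R) (alpha : R -> M) (t : R) :
    tangent (alpha t) :=
  let i := chart_at (alpha t) in
  vec_of (alpha t) i (derive1 (phi i \o alpha) t).

Definition field_along (R : realType) (M : surface R) (alpha : R -> M) : Type :=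
  forall t, tangent (alpha t).

(* The covariant derivative along [alpha] with respect to the parameter: for
   X = \sum_a X^a e_a with e_a the coordinate fields of a chart,
   it is \sum_a ((X^a)' e_a + X^a nabla_{alpha'} e_a).  Any chart around
   [alpha t] gives the same value. *)
Definition cov_along (R : realType) (M : surface R) (nabla : connection M)
    (alpha : R -> M) (X : field_along alpha) : field_along alpha :=
  fun t =>
    let i := chart_at (alpha t) in
    \sum_(a < 2)
      (derive1 (fun s => X s i 0 a : R^o) t *: coord_field i a (alpha t) +
       X t i 0 a *: nabla (alpha t) (velocity alpha t) (coord_field i a)).

Definition nonsingular (R : realType) (M : surface R) (g : metric M)
    (I : set R) (alpha : R -> M) : Prop :=
  forall t, I t -> g (alpha t) (velocity alpha t) (velocity alpha t) != 0.

Definition speed (R : realType) (M : surface R) (g : metric M)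
    (alpha : R -> M) (t : R) : R :=
  Num.sqrt `|g (alpha t) (velocity alpha t) (velocity alpha t)|.

Definition frenetT (R : realType) (M : surface R) (g : metric M)
    (alpha : R -> M) : field_along alpha :=
  fun t => (speed g alpha t)^-1 *: velocity alpha t.

Definition frenetN (R : realType) (M : surface R) (g : metric M)
    (J : forall p : M, tangent p -> tangent p) (alpha : R -> M) :
    field_along alpha :=
  fun t =>
    let T := frenetT g alpha t in
    - (omega g (alpha t) * g (alpha t) T T) *: J (alpha t) T.

(* The covariant derivative along [alpha] with respect to the unit tangent
   field. *)
Definition cov_along_unit (R : realType) (M : surface R) (g : metric M)
    (nabla : connection M) (alpha : R -> M) (X : field_along alpha) :
    field_along alpha :=
  fun t => (speed g alpha t)^-1 *: cov_along nabla X t.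

(* The unique [k] such that nabla_T T = k N at the parameter [t]. *)
Definition frenet_curvature (R : realType) (M : surface R) (g : metric M)
    (nabla : connection M) (J : forall p : M, tangent p -> tangent p)
    (alpha : R -> M) (t : R) : R :=
  xget 0 [set k : R | cov_along_unit g nabla (frenetT g alpha) t =
                      k *: frenetN g J alpha t].

(* Main.v *)
Require Import Defs.
From mathcomp Require Import all_boot all_order all_algebra.
From mathcomp Require Import all_classical all_reals all_analysis.
From mathcomp Require Import ring lra.

(** Let [v] and [a = nabla_v v] be velocity and acceleration, [T] and [N] the
    unit tangent and normal.  As [g(T, T)] is locally constant, differentiating
    it along the curve (metric compatibility along a curve,
    [is_derive_inner_along]) shows that [nabla_T T] is orthogonal to [T]
    ([constant_length_orth]).  In dimension 2 this makes it a multiple of [N],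
    and since [Omega(T, N) = 1] the factor is [Omega(T, nabla_T T)]
    ([orth_normal]).  With [h] the inverse of the speed and [T = h v], the
    Leibniz rule ([cov_alongZ]) gives [nabla_T T = h (h' v + h a)]; the term in
    [h'] is killed by [Omega(v, _)], and what remains is [h ^ 3 Omega(v, a)].
    The second formula is the first one rewritten by the definition of [J] and
    the skew-symmetry of [Omega].

    The normalization [Omega(T, N) = 1] amounts to [J ^ 2 = - omega], which is
    where the signature enters: [omega] is the sign of the Gram determinant
    ([omega_gram]).

    The analytic work is to see that these fields are differentiable in a chart
    fixed near the given parameter, whereas smoothness of the curve, and each
    velocity vector, refer to charts that may vary from point to point. *)

Set Implicit Arguments.
Unset Strict Implicit.
Unset Printing Implicit Defensive.

Import Order.TTheory GRing.Theory Num.Theory.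
Import numFieldNormedType.Exports.

Local Open Scope classical_set_scope.
Local Open Scope ring_scope.

(** * Metric, area form and normal at a point *)

Lemma tangent_combE (R : realType) (M : surface R) (p : M) (x y : R)
    (u v : tangent p) i a :
  (x *: u + y *: v) i 0 a = x * u i 0 a + y * v i 0 a.
Proof.
have -> : (x *: u + y *: v) i = x *: u i + y *: v i by [].
by rewrite !mxE.
Qed.

Lemma coord_fieldE (R : realType) (M : surface R) (p : M) (i : chart M) a b :
  dom i p -> coord_field i a p i 0 b = (a == b)%:R.
Proof. by move=> pi; rewrite /coord_field vec_of_chart// !mxE eq_sym. Qed.

Lemma inner_combl (R : realType) (M : surface R) (g : metric M) (p : M)
    (x y : R) (u v w : tangent p) :
  g p (x *: u + y *: v) w = x * g p u w + y * g p v w.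
Proof.
have g0 : g p 0 w = 0.
  have := inner_linear g 1 0 0 w.
  by rewrite scale1r addr0 mul1r => /esym/(canRL (addrK _)); rewrite subrr.
rewrite inner_linear; congr (_ + _).
by have := inner_linear g y v 0 w; rewrite addr0 g0 addr0.
Qed.

Lemma inner_combr (R : realType) (M : surface R) (g : metric M) (p : M)
    (x y : R) (u v w : tangent p) :
  g p w (x *: u + y *: v) = x * g p w u + y * g p w v.
Proof. by rewrite inner_sym inner_combl !(inner_sym _ w). Qed.

Lemma innerZl (R : realType) (M : surface R) (g : metric M) (p : M) (x : R)
    (u w : tangent p) : g p (x *: u) w = x * g p u w.
Proof.
by have := inner_combl g x 0 u 0 w; rewrite scale0r addr0 mul0r addr0.
Qed.

Lemma innerZr (R : realType) (M : surface R) (g : metric M) (p : M) (x : R)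
    (u w : tangent p) : g p w (x *: u) = x * g p w u.
Proof. by rewrite inner_sym innerZl inner_sym. Qed.

Lemma innerDl (R : realType) (M : surface R) (g : metric M) (p : M)
    (u v w : tangent p) : g p (u + v) w = g p u w + g p v w.
Proof. by have := inner_combl g 1 1 u v w; rewrite !scale1r !mul1r. Qed.

Lemma inner_coord (R : realType) (M : surface R) (g : metric M) (p : M)
    (i : chart M) (u v : tangent p) : dom i p ->
  let e a := @coord_field R M i a p in
  g p u v = u i 0 0 * v i 0 0 * g p (e 0) (e 0)
    + (u i 0 0 * v i 0 1 + u i 0 1 * v i 0 0) * g p (e 0) (e 1)
    + u i 0 1 * v i 0 1 * g p (e 1) (e 1).
Proof.
move=> pi e; rewrite {1}(tangent_coord u pi) {1}(tangent_coord v pi).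
rewrite !inner_combl !inner_combr (inner_sym g (coord_field i 1 p)) /e.
by ring.
Qed.

(** If the Gram determinant vanished, [g01 e0 - g00 e1] would be orthogonal to
    both coordinate vectors, hence zero; then [e0] would be orthogonal to both
    of them as well. *)
Lemma gram_neq0 (R : realType) (M : surface R) (g : metric M) (p : M)
    (i : chart M) : dom i p -> gram g i p != 0.
Proof.
move=> pi; apply/eqP; rewrite /gram /=; set e := fun a => coord_field i a p.
rewrite -/(e 0) -/(e 1) => G0.
have ge (u : tangent p) : g p u (e 0) = 0 -> g p u (e 1) = 0 -> u = 0.
  move=> u0 u1; apply: (inner_nondegenerate (m := g)) => v.
  by rewrite (tangent_coord v pi) inner_combr -/(e 0) -/(e 1) u0 u1; ring.
have /(congr1 (fun u : tangent p => (u i 0 0, u i 0 1))) :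
    g p (e 0) (e 1) *: e 0 + (- g p (e 0) (e 0)) *: e 1 = 0.
  apply: ge; rewrite inner_combl ?(inner_sym g (e 1) (e 0)); first by ring.
  by rewrite -[RHS]oppr0 -G0; ring.
rewrite !tangent_combE !coord_fieldE// eqxx /= => -[].
rewrite !mulr0 !mulr1 addr0 add0r !mxE => e01 /eqP.
rewrite oppr_eq0 => /eqP e00.
have /(congr1 (fun u : tangent p => u i 0 0)) : e 0 = 0 by exact: ge.
by rewrite coord_fieldE// eqxx mxE => /eqP; rewrite oner_eq0.
Qed.

(** Sylvester's criterion for a 2 x 2 form of either sign.  With the Gram
    determinant [G], completing the square gives
    [g00 g(v, v) = (g00 v0 + g01 v1) ^ 2 + G v1 ^ 2], so [G > 0] forces
    definiteness; conversely [w = g01 e0 - g00 e1] has [g(w, w) = g00 G], and for a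
    definite form this has the sign of [g00]. *)
Lemma omega_gram (R : realType) (M : surface R) (g : metric M) (p : M)
    (i : chart M) : dom i p -> gram g i p = omega g p * `|gram g i p|.
Proof.
move=> pi; have G0 := gram_neq0 g pi.
suff D : definite_at g p <-> 0 < gram g i p.
  rewrite /omega; case: asboolP => [/D Gp|nD].
    by rewrite gtr0_norm ?mul1r.
  have Gn : gram g i p < 0.
    by rewrite lt_neqAle G0 leNgt; apply/negP => /D.
  by rewrite ltr0_norm// mulN1r opprK.
move: G0; rewrite /gram /=; set e := fun a => coord_field i a p.
rewrite -/(e 0) -/(e 1).
set E := g p (e 0) (e 0); set F := g p (e 0) (e 1); set K := g p (e 1) (e 1).
move=> G0.
have neq (v : tangent p) a : v i 0 a != 0 -> v != 0.
  by apply: contra => /eqP ->; rewrite mxE.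
have e0 : e 0 != 0 by apply: (neq _ 0); rewrite coord_fieldE// eqxx oner_eq0.
have w0 : E != 0 -> F *: e 0 + (- E) *: e 1 != 0.
  move=> E0; apply: (neq _ 1); rewrite tangent_combE !coord_fieldE//= ?eqxx.
  by rewrite mulr0 add0r mulr1 oppr_eq0.
have gw : let w := F *: e 0 + (- E) *: e 1 in g p w w = E * (E * K - F ^+ 2).
  rewrite /= !inner_combl !inner_combr (inner_sym g (e 1) (e 0)) -/E -/F -/K.
  by ring.
have Eg (v : tangent p) : E * g p v v =
    (E * v i 0 0 + F * v i 0 1) ^+ 2 + (E * K - F ^+ 2) * v i 0 1 ^+ 2.
  by rewrite (inner_coord g v v pi) /= -/(e 0) -/(e 1) -/E -/F -/K; ring.
split=> [[] H|Gp].
- have Ep := H _ e0; have := H _ (w0 (lt0r_neq0 Ep)).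
  by rewrite gw pmulr_rgt0.
- have En := H _ e0; have := H _ (w0 (ltr0_neq0 En)).
  by rewrite gw nmulr_rlt0.
have E0 : E != 0.
  by apply/eqP => E0; move: Gp; rewrite E0 mul0r sub0r ltNge oppr_le0 sqr_ge0.
have Egp (v : tangent p) : v != 0 -> 0 < E * g p v v.
  move=> v0; rewrite Eg; have [v1|v1] := eqVneq (v i 0 1) 0; last first.
    by rewrite ltr_wpDl ?sqr_ge0// mulr_gt0// lt0r sqr_ge0 sqrf_eq0 v1.
  rewrite v1 mulr0 addr0 expr0n mulr0 addr0 lt0r sqr_ge0 sqrf_eq0 mulf_neq0//.
  apply: contra v0 => /eqP v00; rewrite (tangent_coord v pi) v00 v1.
  by rewrite !scale0r addr0.
case: (ltgtP E 0) E0 => // Es _; [right|left] => v /Egp.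
  by rewrite nmulr_rgt0.
by rewrite pmulr_rgt0.
Qed.

Lemma sqr_omega (R : realType) (M : surface R) (g : metric M) (p : M) :
  omega g p ^+ 2 = 1.
Proof. by rewrite /omega; case: asboolP; rewrite ?sqrrN expr1n. Qed.

Lemma Omega_combr (R : realType) (M : surface R) (g : metric M) (p : M)
    (x y : R) (u v w : tangent p) :
  Omega g u (x *: v + y *: w) = x * Omega g u v + y * Omega g u w.
Proof. by rewrite /Omega !tangent_combE; ring. Qed.

Lemma OmegaC (R : realType) (M : surface R) (g : metric M) (p : M)
    (u v : tangent p) : Omega g u v = - Omega g v u.
Proof. by rewrite /Omega; ring. Qed.

Lemma OmegaZr (R : realType) (M : surface R) (g : metric M) (p : M) (x : R)
    (u v : tangent p) : Omega g u (x *: v) = x * Omega g u v.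
Proof.
by have := Omega_combr g x 0 u v 0; rewrite scale0r addr0 mul0r addr0.
Qed.

Lemma OmegaZl (R : realType) (M : surface R) (g : metric M) (p : M) (x : R)
    (u v : tangent p) : Omega g (x *: u) v = x * Omega g u v.
Proof. by rewrite OmegaC OmegaZr -mulrN -OmegaC. Qed.

(** This is [J ^ 2 = - omega] in the form in which it is used: by the defining
    property of [J], [Omega(v, J v) = g(v, J (J v))].  The defining property
    on the two coordinate vectors is a linear system for [J v], which is solved
    by Cramer's rule. *)
Lemma Omega_J (R : realType) (M : surface R) (g : metric M)
    (J : forall p : M, tangent p -> tangent p) (HJ : natural_J g J) (p : M)
    (v : tangent p) : Omega g v (J p v) = - (omega g p * g p v v).
Proof.
have pi := chart_atP p; set i := chart_at p in pi.
have w0 := sqr_omega g p.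
have /eqP G0 := gram_neq0 g pi; have GE := omega_gram g pi.
have dd : Num.sqrt `|gram g i p| ^+ 2 = `|gram g i p| by rewrite sqr_sqrtr.
have := HJ p (coord_field i 0 p) v; have := HJ p (coord_field i 1 p) v.
rewrite !(OmegaE g _ _ pi) (inner_coord g v v pi).
rewrite (inner_coord g (coord_field i 0 p) (J p v) pi).
rewrite (inner_coord g (coord_field i 1 p) (J p v) pi) !coord_fieldE//=.
move: dd GE G0; set n : R := `|_|; move: (Num.sqrt n) => d; move: n => n.
rewrite /gram /= => dd GE G0.
move: (g p _ _) (g p _ _) (g p _ _) GE G0 => F K E GE G0 J1 J0.
(* The Gram determinant, the determinant of the system [J0], [J1], clears the
   denominators of its solution. *)
apply: (mulfI (x := E * K - F ^+ 2)); first exact/eqP.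
transitivity (- (d ^+ 2) * (v i 0 0 * v i 0 0 * E +
   (v i 0 0 * v i 0 1 + v i 0 1 * v i 0 0) * F + v i 0 1 * v i 0 1 * K)).
  transitivity (d * v i 0 0 * (E * (d * (0 * v i 0 1 - v i 0 0 * 1))
    - F * (d * (1 * v i 0 1 - v i 0 0 * 0)))
    - d * v i 0 1 * (K * (d * (1 * v i 0 1 - v i 0 0 * 0))
      - F * (d * (0 * v i 0 1 - v i 0 0 * 1)))); last by ring.
  by rewrite -J0 -J1; ring.
rewrite dd GE; ring: w0.
Qed.

(** The vanishing of [Omega(u, w)] makes [w] parallel to [u], and a multiple
    of a non-isotropic vector that is orthogonal to it is zero. *)
Lemma Omega_orth_eq0 (R : realType) (M : surface R) (g : metric M) (p : M)
    (u w : tangent p) :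
  g p u u != 0 -> Omega g u w = 0 -> g p u w = 0 -> w = 0.
Proof.
have pi := chart_atP p; set i := chart_at p in pi.
move=> u0 /eqP; rewrite (OmegaE g _ _ pi) mulf_eq0 sqrtr_eq0 normr_le0.
rewrite (negbTE (gram_neq0 g pi)) /= subr_eq0 => /eqP O0 uw0.
have H a : g p u u * w i 0 a = 0.
  transitivity (u i 0 a * g p u w); last by rewrite uw0 mulr0.
  rewrite (inner_coord g u u pi) (inner_coord g u w pi) /=.
  have [->|->] : a = 0 \/ a = 1.
    by case: a => -[|[|//]] ia; [left|right]; exact/val_inj.
  - ring: O0.
  - ring: O0.
rewrite (tangent_coord w pi).
have Z a : w i 0 a = 0.
  by have /eqP := H a; rewrite mulf_eq0 (negbTE u0) => /eqP.
by rewrite !Z !scale0r addr0.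
Qed.

(** This yields both the existence and the uniqueness of the curvature, for [u]
    the unit tangent.  The vector multiplied by [k] is the oriented normal [n]
    of [u]: it is orthogonal to [u] and [Omega(u, n) = 1], so that
    [w - Omega(u, w) n] is annihilated by both [g(u, _)] and [Omega(u, _)]. *)
Lemma orth_normal (R : realType) (M : surface R) (g : metric M)
    (J : forall p : M, tangent p -> tangent p) (HJ : natural_J g J) (p : M)
    (u w : tangent p) (k : R) : g p u u ^+ 2 = 1 -> g p w u = 0 ->
  w = k *: (- (omega g p * g p u u) *: J p u) <-> k = Omega g u w.
Proof.
move=> u1 wu.
have w1 := sqr_omega g p.
have On : Omega g u (- (omega g p * g p u u) *: J p u) = 1.
  by rewrite OmegaZr (Omega_J HJ); ring: u1 w1.
have gn : g p u (- (omega g p * g p u u) *: J p u) = 0.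
  by rewrite innerZr HJ /Omega; ring.
move: (_ *: J p u) On gn => n On gn.
split=> [->|->]; first by rewrite OmegaZr On mulr1.
apply/eqP; rewrite -subr_eq0; apply/eqP.
have -> : w - Omega g u w *: n = 1 *: w + (- Omega g u w) *: n.
  by rewrite scale1r scaleNr.
apply: (Omega_orth_eq0 (g := g) (u := u)).
- by rewrite -sqrf_eq0 u1 oner_eq0.
- by rewrite Omega_combr On; ring.
- by rewrite inner_combr gn (inner_sym g u) wu; ring.
Qed.

(** * Differentiability in charts *)

(** The differential of [f] satisfies the first-order expansion that
    characterizes the one of [g], because both are local conditions. *)
Lemma near_eq_differentiable (R : realType) (V W : normedModType R)
    (f g : V -> W) (x : V) :
  (\forall y \near x, f y = g y) -> differentiable f x -> differentiable g x.
Proof.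
move=> fg df; have [dfc dfE] := (diff_locallyP x f).1 df.
have gE : g \o shift x = cst (g x) + 'd f x +o_ 0 id.
  apply/eqaddoP => e e0; move/eqaddoP: dfE => /(_ e e0).
  have fgs : \forall h \near (0 : V), f (h + x) = g (h + x).
    move: fg; rewrite (near_shift 0)/=.
    by apply: filterS => h /=; rewrite subr0.
  apply: filterS2 fgs => h fgh.
  by rewrite /= !fctE /= fgh (nbhs_singleton fg).
by apply/diff_locallyP; rewrite (diff_unique dfc gE).
Qed.

Lemma Ck_cst (R : realType) (V W : normedModType R) (O : set V) (c : W)
    (f : V -> W) k :
  open O -> (forall x, O x -> f x = c) -> Ck k O f.
Proof.
move=> Oo; elim: k f c => [|k IH] f c fc.
  move=> x Ox; have nc : \forall y \near x, c = f y.
    by apply: filterS (open_nbhs_nbhs (conj Oo Ox)) => y /fc.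
  apply: differentiable_continuous.
  exact: (@near_eq_differentiable _ _ _ (cst c)).
have nc x : O x -> \forall y \near x, c = f y.
  by move=> Ox; apply: filterS (open_nbhs_nbhs (conj Oo Ox)) => y /fc.
split=> [x /nc|v]; first by move=> /near_eq_differentiable; exact.
apply: (IH _ 0) => x /nc ncx.
by rewrite -(@near_eq_derive _ _ _ (cst c) f x v ncx) derive_cst.
Qed.

(** In its own chart a coordinate field has constant components. *)
Lemma coord_field_smooth (R : realType) (M : surface R) (i : chart M) a
    (p : M) : dom i p -> smooth_field_at (coord_field i a) p.
Proof.
move=> pi; exists i => //; exists (phi i @` dom i).
  by split; [exact: im_open|exists p].
move=> k; apply: (@Ck_cst _ _ _ _ (delta_mx 0 a)); first exact: im_open.
by move=> _ [q qi <-]; rewrite phiK// /coord_field vec_of_chart.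
Qed.

Lemma near_dom (R : realType) (M : surface R) (T : topologicalType)
    (f : T -> M) (x : T) (i : chart M) :
  {for x, continuous f} -> dom i (f x) -> \forall y \near x, dom i (f y).
Proof.
move=> fc fx; apply: fc; apply: open_nbhs_nbhs; split=> //; exact: dom_open.
Qed.

(** Smoothness at a point is witnessed by one chart only; the transition maps
    carry differentiability over to any other, in particular to the chart in
    which [dird] is computed. *)
Lemma smooth_fun_differentiable (R : realType) (M : surface R) (f : M -> R)
    (p : M) (i : chart M) : smooth_fun_at f p -> dom i p ->
  differentiable (f \o psi i : 'rV[R]_2 -> R^o) (phi i p).
Proof.
move=> [j pj /smooth_near_differentiable fj] pi.
have E : transition i j (phi i p) = phi j p by rewrite /transition /= phiK.
apply: (@near_eq_differentiable _ _ _ ((f \o psi j) \o transition i j)).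
  have := near_dom (f := psi i) (x := phi i p) (i := j) (psi_continuous pi).
  rewrite phiK// => /(_ pj); apply: filterS => x xj.
  by rewrite /transition /= phiK.
apply: differentiable_comp; first exact: trans_differentiable.
by rewrite E.
Qed.

Lemma curve_differentiable (R : realType) (M : surface R) (I : set R)
    (alpha : R -> M) (t : R) (i : chart M) : smooth_curve I alpha -> I t ->
  dom i (alpha t) -> differentiable (phi i \o alpha : R^o -> _) t.
Proof.
move=> Ha /Ha [ac [j tj /smooth_near_differentiable aj]] ti.
apply: (@near_eq_differentiable _ _ _ (transition j i \o (phi j \o alpha))).
  apply: filterS (near_dom ac tj) => s sj.
  by rewrite /transition /= phiK.
apply: differentiable_comp => //; exact: trans_differentiable.
Qed.

Lemma derive1_transition (R : realType) (M : surface R) (I : set R)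
    (alpha : R -> M) (t : R) (i j : chart M) : smooth_curve I alpha -> I t ->
  dom i (alpha t) -> dom j (alpha t) ->
  derive1 (phi j \o alpha) t =
  'd (transition i j) (phi i (alpha t)) (derive1 (phi i \o alpha) t).
Proof.
move=> Ha It ti tj; have [ac _] := Ha t It.
rewrite !derive1E'; try exact: (curve_differentiable (I := I)).
symmetry; apply: (diff_near_comp (f := phi i \o alpha : R^o -> _)).
- exact: (curve_differentiable (I := I)).
- exact: trans_differentiable.
- exact: (curve_differentiable (I := I)).
apply: filterS (near_dom ac ti) => s si.
by rewrite /transition /= phiK.
Qed.

Lemma velocity_chart (R : realType) (M : surface R) (I : set R)
    (alpha : R -> M) (t : R) (i : chart M) : smooth_curve I alpha -> I t ->
  dom i (alpha t) -> velocity alpha t i = derive1 (phi i \o alpha) t.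
Proof.
move=> Ha It ti; rewrite (derive1_transition (i := chart_at (alpha t)) Ha It)//.
  rewrite /velocity /= /vec_comp; case: asboolP => // -[]; split=> //.
  exact: chart_atP.
exact: chart_atP.
Qed.

(** Near [t] the components in [i] are those of
    ['d (transition j i)] at [c] applied to the derivative of [c], where
    [c = phi j \o alpha] is smooth at [t].  Written with partial derivatives
    of the transition map this is a sum of products of differentiable
    functions. *)
Lemma velocity_derivable (R : realType) (M : surface R) (I : set R)
    (alpha : R -> M) (t : R) (i : chart M) a : open I -> smooth_curve I alpha ->
  I t -> dom i (alpha t) ->
  derivable (fun s => velocity alpha s i 0 a : R^o) t 1.
Proof.
move=> Io Ha It ti; have [ac [j tj [U [Uo Ut] aU]]] := Ha t It.
have [P0 [Po Pt] tP] := trans_smooth tj ti.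
pose c := phi j \o alpha : R^o -> 'rV[R]_2.
pose e b := delta_mx 0 b : 'rV[R]_2.
pose F s := \sum_(b < 2)
  ('D_1 c s 0 b * ('D_(e b) (transition j i) (c s)) 0 a) : R^o.
have nI : \forall s \near t, I s by apply: open_nbhs_nbhs.
have FE : \forall s \near t, F s = velocity alpha s i 0 a.
  have [ni nj] := (near_dom ac ti, near_dom ac tj).
  apply: filterS3 nI ni nj => s Is si sj; rewrite (velocity_chart Ha Is)//.
  rewrite (derive1_transition (i := j) Ha Is)// derive1E /F -/c.
  have dt := trans_differentiable sj si.
  rewrite [in RHS](row_sum_delta ('D_1 c s)) linear_sum summxE.
  by apply: eq_bigr => b _; rewrite linearZ mxE (deriveE _ dt).
suff : derivable F t 1 by exact: near_eq_derivable.
pose G b s := 'D_1 c s 0 b * ('D_(e b) (transition j i) (c s)) 0 a : R^o.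
have -> : F = G ord0 + G (lift ord0 ord0).
  by apply/funext => s; rewrite /F big_ord_recl big_ord1.
have dc : differentiable c t by have [/(_ t Ut)] := aU 1%N.
have dc' b : derivable (fun s => 'D_1 c s 0 b : R^o) t 1.
  have [_ /(_ 1)[/(_ t Ut) d2 _]] := aU 2%N.
  by move/derivable1_diffP/derivable_mxP: d2.
have dD b : derivable (fun s => 'D_(e b) (transition j i) (c s) 0 a : R^o) t 1.
  have [_ /(_ (e b))[/(_ _ Pt) d2 _]] := tP 2%N.
  have /derivable1_diffP/derivable_mxP : differentiable
    ('D_(e b) (transition j i) \o c) t by exact: differentiable_comp.
  exact.
by apply: derivableD; apply: derivableM.
Qed.

Lemma is_derive_fun_along (R : realType) (M : surface R) (I : set R)
    (alpha : R -> M) (t : R) (f : M -> R) : smooth_curve I alpha -> I t ->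
  smooth_fun_at f (alpha t) ->
  is_derive t 1 (fun s => f (alpha s) : R^o) (dird (velocity alpha t) f).
Proof.
move=> Ha It sf; have [ac _] := Ha t It.
have ti := chart_atP (alpha t).
rewrite /dird; set i := chart_at _ in ti *.
have df := smooth_fun_differentiable sf ti.
have da := curve_differentiable Ha It ti.
apply: (@near_eq_is_derive _ _ _ ((f \o psi i) \o (phi i \o alpha))).
  by apply: filterS (near_dom ac ti) => s si; rewrite /= phiK.
split; first exact/derivable1_diffP/differentiable_comp.
rewrite (velocity_chart Ha It ti) (derive1E' da) -derive1E derive1E'.
  by rewrite diff_comp.
exact: differentiable_comp.
Qed.

(** The chart is the one that [cov_along] uses at the parameter [t]; it stays
    fixed while the parameter of the field varies. *)
Definition field_derivable (R : realType) (M : surface R) (alpha : R -> M)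
    (X : field_along alpha) (t : R) : Prop :=
  forall a, derivable (fun s => X s (chart_at (alpha t)) 0 a : R^o) t 1.

Lemma velocity_field_derivable (R : realType) (M : surface R) (I : set R)
    (alpha : R -> M) (t : R) : open I -> smooth_curve I alpha -> I t ->
  field_derivable (velocity alpha) t.
Proof.
by move=> Io Ha It a; exact: velocity_derivable Io Ha It (chart_atP _).
Qed.

(** * Covariant differentiation along a curve *)

Lemma cov_alongE (R : realType) (M : surface R) (nabla : connection M)
    (alpha : R -> M) (X : field_along alpha) (t : R) :
  cov_along nabla X t =
  (derive1 (fun s => X s (chart_at (alpha t)) 0 0 : R^o) t
     *: coord_field (chart_at (alpha t)) 0 (alpha t)
   + X t (chart_at (alpha t)) 0 0 *:
     nabla (alpha t) (velocity alpha t) (coord_field (chart_at (alpha t)) 0)) +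
  (derive1 (fun s => X s (chart_at (alpha t)) 0 1 : R^o) t
     *: coord_field (chart_at (alpha t)) 1 (alpha t)
   + X t (chart_at (alpha t)) 0 1 *:
     nabla (alpha t) (velocity alpha t) (coord_field (chart_at (alpha t)) 1)).
Proof.
rewrite /cov_along big_ord_recl big_ord1 (_ : lift ord0 ord0 = 1)//.
exact/val_inj.
Qed.

Lemma field_derivableZ (R : realType) (M : surface R) (alpha : R -> M)
    (X : field_along alpha) (h : R -> R) (t : R) :
  derivable (h : R -> R^o) t 1 -> field_derivable X t ->
  field_derivable (fun s => h s *: X s) t.
Proof.
move=> dh dX a.
have -> : (fun s => (h s *: X s) (chart_at (alpha t)) 0 a : R^o) =
    h * (fun s => X s (chart_at (alpha t)) 0 a).
  by apply/funext => s; rewrite mxE.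
exact: derivableM.
Qed.

Lemma cov_alongZ (R : realType) (M : surface R) (nabla : connection M)
    (alpha : R -> M) (X : field_along alpha) (h : R -> R) (t : R) :
  derivable (h : R -> R^o) t 1 -> field_derivable X t ->
  cov_along nabla (fun s => h s *: X s : tangent (alpha s)) t =
  derive1 h t *: X t + h t *: cov_along nabla X t.
Proof.
move=> dh dX; rewrite !cov_alongE.
have D a : derive1 (fun s => (h s *: X s) (chart_at (alpha t)) 0 a : R^o) t =
    h t * derive1 (fun s => X s (chart_at (alpha t)) 0 a : R^o) t
    + derive1 h t * X t (chart_at (alpha t)) 0 a.
  have -> : (fun s => (h s *: X s) (chart_at (alpha t)) 0 a : R^o) =
      h * (fun s => X s (chart_at (alpha t)) 0 a).
    by apply/funext => s; rewrite mxE.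
  by rewrite !derive1E deriveM//= (mulrC ('D_1 h t)).
have pi := chart_atP (alpha t).
rewrite !D [in X in _ = X + _](tangent_coord (X t) pi).
move: (chart_at _) pi => i pi.
have Z a : (h t *: X t) i 0 a = h t * X t i 0 a by rewrite mxE.
rewrite !Z !scalerDr !scalerDl !scalerA.
by rewrite [RHS](AC (2*(2*2)) ((3*1*4)*(5*2*6))).
Qed.

(** Metric compatibility is about fields on the surface.  It is applied to the
    coordinate fields, after [g(X, Y)] has been expanded in the chart; the
    derivatives of the components supply the remaining terms of the two
    covariant derivatives. *)
Lemma is_derive_inner_along (R : realType) (M : surface R) (g : metric M)
    (nabla : connection M) (I : set R) (alpha : R -> M)
    (X Y : field_along alpha) (t : R) :
  metric_compatible g nabla -> smooth_curve I alpha -> I t ->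
  field_derivable X t -> field_derivable Y t ->
  is_derive t 1 (fun s => g (alpha s) (X s) (Y s) : R^o)
    (g (alpha t) (cov_along nabla X t) (Y t) +
     g (alpha t) (X t) (cov_along nabla Y t)).
Proof.
move=> mc Ha It; rewrite /field_derivable !cov_alongE.
have ti := chart_atP (alpha t); move: (chart_at _) ti => i ti dX dY.
pose e a := @coord_field R M i a.
pose G a b q := g q (e a q) (e b q).
have se a : smooth_field_at (e a) (alpha t) by exact: coord_field_smooth.
have dG a b : is_derive t 1 (fun s => G a b (alpha s) : R^o)
    (g (alpha t) (nabla _ (velocity alpha t) (e a)) (e b (alpha t)) +
     g (alpha t) (e a (alpha t)) (nabla _ (velocity alpha t) (e b))).
  rewrite -mc//; apply: (is_derive_fun_along Ha It).
  by apply: inner_smooth.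
pose x a s := X s i 0 a : R^o; pose y a s := Y s i 0 a : R^o.
have [ac _] := Ha t It.
apply: (@near_eq_is_derive _ _ _ (fun s =>
   x 0 s * y 0 s * G 0 0 (alpha s)
   + (x 0 s * y 1 s + x 1 s * y 0 s) * G 0 1 (alpha s)
   + x 1 s * y 1 s * G 1 1 (alpha s) : R^o)).
  apply: filterS (near_dom ac ti) => s si.
  by rewrite (inner_coord g (X s) (Y s) si).
have dx a : is_derive t 1 (x a) (derive1 (x a) t).
  by rewrite derive1E; apply: derivableP; exact: dX.
have dy a : is_derive t 1 (y a) (derive1 (y a) t).
  by rewrite derive1E; apply: derivableP; exact: dY.
have gX w : g (alpha t) w (X t) =
    x 0 t * g (alpha t) w (e 0 _) + x 1 t * g (alpha t) w (e 1 _).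
  by rewrite {1}(tangent_coord (X t) ti) inner_combr.
have gY w : g (alpha t) w (Y t) =
    y 0 t * g (alpha t) w (e 0 _) + y 1 t * g (alpha t) w (e 1 _).
  by rewrite {1}(tangent_coord (Y t) ti) inner_combr.
rewrite (inner_sym g (X t)) !innerDl !innerZl !gX !gY -/(e 0) -/(e 1).
apply: is_derive_eq.
rewrite /GRing.scale /= /G -/(x 0) -/(x 1) -/(y 0) -/(y 1).
rewrite -/(x 0 t) -/(x 1 t) -/(y 0 t) -/(y 1 t).
rewrite !(inner_sym g (e 1 _) (e 0 _)) !(inner_sym g (e _ _) (nabla _ _ _)).
ring.
Qed.

Lemma constant_length_orth (R : realType) (M : surface R) (g : metric M)
    (nabla : connection M) (I : set R) (alpha : R -> M)
    (X : field_along alpha) (c t : R) :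
  metric_compatible g nabla -> smooth_curve I alpha -> I t ->
  field_derivable X t -> (\forall s \near t, g (alpha s) (X s) (X s) = c) ->
  g (alpha t) (cov_along nabla X t) (X t) = 0.
Proof.
move=> mc Ha It dX Xc; have [_] := is_derive_inner_along mc Ha It dX dX.
rewrite (@near_eq_derive _ _ _ _ (cst c) _ _ Xc) derive_cst.
by rewrite (inner_sym g (X t)); lra.
Qed.

(** * The inverse of the speed *)

Lemma sqr_invsqrt (R : realType) (x : R) : x != 0 ->
  (Num.sqrt `|x|)^-1 ^+ 2 * x = Num.sg x.
Proof.
move=> x0; rewrite exprVn sqr_sqrtr// {2}[x]numEsg mulrCA mulVf ?normr_eq0//.
by rewrite mulr1.
Qed.

Lemma near_sgr (R : realType) (f : R -> R) (t : R) : {for t, continuous f} ->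
  f t != 0 -> \forall s \near t, Num.sg (f s) = Num.sg (f t).
Proof.
move=> fc; case: ltgtP => // ft _.
- rewrite (ltr0_sg ft); have : \forall s \near t, f s < 0.
    by exact: cvgr_lt fc _ ft.
  by apply: filterS => s /ltr0_sg.
- rewrite (gtr0_sg ft); have : \forall s \near t, 0 < f s.
    by exact: cvgr_gt fc _ ft.
  by apply: filterS => s /gtr0_sg.
Qed.

(** The absolute value is harmless: as [f t] is nonzero, [|f|] coincides near
    [t] with [f] times the constant [Num.sg (f t)]. *)
Lemma derivable_invsqrt (R : realType) (f : R -> R) (t : R) :
  derivable (f : R -> R^o) t 1 -> f t != 0 ->
  derivable (fun s => (Num.sqrt `|f s|)^-1 : R^o) t 1.
Proof.
move=> df f0; have fc : {for t, continuous f}.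
  exact/differentiable_continuous/derivable1_diffP.
apply: derivableV; first by rewrite sqrtr_eq0 -ltNge normr_gt0.
have sE : \forall s \near t, Num.sqrt (Num.sg (f t) * f s) = Num.sqrt `|f s|.
  by apply: filterS (near_sgr fc f0) => s <-; rewrite -normrEsg.
suff : derivable (Num.sqrt \o (Num.sg (f t) *: f) : R -> R^o) t 1.
  exact: near_eq_derivable.
apply/derivable1_diffP/differentiable_comp.
  exact/derivable1_diffP/derivableZ.
apply/derivable1_diffP; rewrite fctE /GRing.scale /= -normrEsg.
by have [] := @is_derive1_sqrt _ `|f t|; rewrite ?normr_gt0.
Qed.

(** * The Frenet curvature *)

Theorem theorem3 (R : realType) (M : surface R) (g : metric M)
    (nabla : connection M) (Hnabla : levi_civita g nabla)
    (J : forall p : M, tangent p -> tangent p) (HJ : natural_J g J)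
    (I : set R) (Iopen : open I) (Iitv : is_interval I)
    (alpha : R -> M) (Halpha : smooth_curve I alpha)
    (Hns : nonsingular g I alpha) :
  forall t : R, I t ->
    let v := velocity alpha t in
    let a := cov_along nabla (velocity alpha) t in
    frenet_curvature g nabla J alpha t
      = Omega g v a / `|g (alpha t) v v| `^ (3 / 2)
    /\ frenet_curvature g nabla J alpha t
      = - (g (alpha t) a (J (alpha t) v) / `|g (alpha t) v v| `^ (3 / 2)).
Proof.
move=> t It v a; have [_ mc] := Hnabla.
(* [g(a, J v) = Omega(a, v) = - Omega(v, a)] reduces to the first formula. *)
rewrite HJ (OmegaC g a) mulNr opprK.
suff -> : frenet_curvature g nabla J alpha t =
  Omega g v a / `|g (alpha t) v v| `^ (3 / 2) by [].
have vd s : I s -> field_derivable (velocity alpha) s.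
  exact: velocity_field_derivable.
pose f s := g (alpha s) (velocity alpha s) (velocity alpha s).
pose h s := (speed g alpha s)^-1.
have df : derivable (f : R -> R^o) t 1.
  by have [] := is_derive_inner_along mc Halpha It (vd t It) (vd t It).
have f0 : f t != 0 := Hns t It.
have dh : derivable (h : R -> R^o) t 1 by exact: derivable_invsqrt.
have dT := field_derivableZ dh (vd t It).
have TT s : I s -> g (alpha s) (frenetT g alpha s) (frenetT g alpha s) =
    Num.sg (f s).
  move=> Is; rewrite /frenetT innerZl innerZr mulrA -expr2.
  exact: sqr_invsqrt (Hns s Is).
have Tc : \forall s \near t,
    g (alpha s) (frenetT g alpha s) (frenetT g alpha s) = Num.sg (f t).
  have nI : \forall s \near t, I s by apply: open_nbhs_nbhs.
  have fc : {for t, continuous f}.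
    exact/differentiable_continuous/derivable1_diffP.
  by apply: filterS2 nI (near_sgr fc f0) => s Is <-; exact: TT.
have DT := constant_length_orth mc Halpha It dT Tc.
have T1 : g (alpha t) (frenetT g alpha t) (frenetT g alpha t) ^+ 2 = 1.
  by rewrite TT// sqr_sg f0.
have WT : g (alpha t) (cov_along_unit g nabla (frenetT g alpha) t)
    (frenetT g alpha t) = 0 by rewrite /cov_along_unit innerZl DT mulr0.
have -> : frenet_curvature g nabla J alpha t =
    Omega g (frenetT g alpha t) (cov_along_unit g nabla (frenetT g alpha) t).
  apply: xget_unique => [|k].
    exact/(orth_normal HJ _ T1 WT).
  by move/(orth_normal HJ _ T1 WT).
rewrite /cov_along_unit (cov_alongZ nabla dh (vd t It)).
(* The derivative of the inverse speed multiplies [Omega(v, v) = 0]. *)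
rewrite OmegaZr OmegaZl Omega_combr (_ : Omega g _ (velocity alpha t) = 0).
  have -> : `|g (alpha t) v v| `^ (3 / 2) = speed g alpha t ^+ 3.
    by rewrite mulrC powRrM powR12_sqrt// powR_mulrn.
  by rewrite -/(h t) -exprVn -/(h t) -/a -/v; ring.
by rewrite /Omega; ring.
Qed.
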